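(* If $p>L_f$, then $$\|x(y,z)-\bar x^*(z)\|\le\bar\sigma_5\|Ax(y,z)-b\|\quad\text{for all } y\in\mathbb R^m,\ z\in\mathbb R^n,$$ where $\bar\sigma_5>0$ is a constant depending only on $L=L_f+\rho\sigma_{\max}^2(A)+p$, $\gamma=p-L_f$ and the matrices $A$, $G$.
   Context: Let $P=\{x\in\mathbb R^n: Gx\preceq h\}$ be polyhedral, with $A\in\mathbb R^{m\times n}$, $G\in\mathbb R^{l\times n}$, $b\in\mathbb R^m$, $h\in\mathbb R^l$, and $\{x\in P: Ax=b\}$ nonempty. $\sigma_{\max}(A)$ is the largest singular value of $A$; norms are Euclidean. The function $f$ (possibly nonconvex) is smooth, $\|\nabla f(x)-\nabla f(x')\|\le L_f\|x-x'\|$ for all $x,x'\in P$, and $f$ is bounded below on $\{x\in P: Ax=b\}$. For $\rho\ge 0$ and a positive constant $p>L_f$ let $K(x,z;y)=f(x)+y^T(Ax-b)+\frac\rho2\|Ax-b\|^2+\frac p2\|x-z\|^2$, $x(y,z)=\arg\min_{x\in P}K(x,z;y)$, $\bar x^*(z)=\arg\min_{x\in P,\,Ax=b}\{f(x)+\frac p2\|x-z\|^2\}$. *)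

(* Defs.v *)
From mathcomp Require Import all_boot all_order all_algebra.
From mathcomp Require Import all_classical all_reals all_analysis.
Set Implicit Arguments.
Unset Strict Implicit.
Unset Printing Implicit Defensive.
Import Order.TTheory GRing.Theory Num.Theory.
Import numFieldNormedType.Exports.
Local Open Scope classical_set_scope.
Local Open Scope ring_scope.

Section Defs.
Context {R : realType}.

(* The canonical norm `|x| on matrices is the sup norm, hence this one. *)
Definition enorm {n : nat} (x : 'cV[R]_n) : R :=
  Num.sqrt (\sum_(i < n) x i 0 ^+ 2).

Definition dotv {n : nat} (x y : 'cV[R]_n) : R := \sum_(i < n) x i 0 * y i 0.

(* The set of singular values may lack or include 0 according to the chosen
   convention; this does not affect the supremum, which is 0 when n = 0. *)
Definition singular_values {m n : nat} (A : 'M[R]_(m, n)) : set R :=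
  [set s | 0 <= s /\ eigenvalue (A^T *m A) (s ^+ 2)].

Definition sigma_max {m n : nat} (A : 'M[R]_(m, n)) : R :=
  sup (singular_values A).

Definition polyhedron {l n : nat} (G : 'M[R]_(l, n)) (h : 'cV[R]_l) :
    set 'cV[R]_n :=
  [set x | forall i, (G *m x) i 0 <= h i 0].

Definition feasible {m l n : nat} (A : 'M[R]_(m, n)) (b : 'cV[R]_m)
    (G : 'M[R]_(l, n)) (h : 'cV[R]_l) : set 'cV[R]_n :=
  polyhedron G h `&` [set x | A *m x = b].

Definition gradient {n : nat} (f : 'cV[R]_n -> R) (x : 'cV[R]_n) : 'cV[R]_n :=
  \col_(i < n) 'D_(delta_mx i 0) f x.

Definition smooth {n : nat} (f : 'cV[R]_n -> R) : Prop :=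
  (forall x, differentiable f x) /\ continuous (gradient f).

Definition is_argmin {n : nat} (S : set 'cV[R]_n) (F : 'cV[R]_n -> R)
    (x : 'cV[R]_n) : Prop :=
  S x /\ forall x', S x' -> F x <= F x'.

(* A minimizer of F over S, selected by choice; a default value if there is
   none. *)
Definition argmin {n : nat} (S : set 'cV[R]_n) (F : 'cV[R]_n -> R) : 'cV[R]_n :=
  [get x | is_argmin S F x].

Definition K {m n : nat} (A : 'M[R]_(m, n)) (b : 'cV[R]_m)
    (f : 'cV[R]_n -> R) (rho p : R) (x z : 'cV[R]_n) (y : 'cV[R]_m) : R :=
  f x + dotv y (A *m x - b) + rho / 2 * enorm (A *m x - b) ^+ 2
  + p / 2 * enorm (x - z) ^+ 2.

Definition x_of {m l n : nat} (A : 'M[R]_(m, n)) (b : 'cV[R]_m)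
    (G : 'M[R]_(l, n)) (h : 'cV[R]_l) (f : 'cV[R]_n -> R) (rho p : R)
    (y : 'cV[R]_m) (z : 'cV[R]_n) : 'cV[R]_n :=
  argmin (polyhedron G h) (fun x => K A b f rho p x z y).

Definition xbar_star {m l n : nat} (A : 'M[R]_(m, n)) (b : 'cV[R]_m)
    (G : 'M[R]_(l, n)) (h : 'cV[R]_l) (f : 'cV[R]_n -> R) (p : R)
    (z : 'cV[R]_n) : 'cV[R]_n :=
  argmin (feasible A b G h) (fun x => f x + p / 2 * enorm (x - z) ^+ 2).

End Defs.

(* Main.v *)
Require Import Defs.
From mathcomp Require Import all_boot all_order all_algebra.
From mathcomp Require Import all_classical all_reals all_analysis.
From mathcomp Require Import lra.
Import Order.TTheory GRing.Theory Num.Theory.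
Import numFieldNormedType.Exports.
Local Open Scope classical_set_scope.
Local Open Scope ring_scope.

(** Write [F x = f x + p / 2 * |x - z|^2].  On the polyhedron [P] its gradient
    is strongly monotone with constant [gamma = p - Lf] and Lipschitz with a
    constant at most [L].  Let [x] be the minimizer of the augmented
    Lagrangian over [P] and [xs] that of [F] over [P] and [A x = b].  In the
    first-order condition for [x], the terms coming from [y] and [rho] are of
    the form [A^T w]; they vanish on directions that keep [A x] fixed.  Hence
    [x] solves the variational inequality of [F] over the slice of [P] where
    [A u = A x], whatever [y] is, while [xs] solves it over the slice where
    [A u = b].  The claim is therefore that the solution of a strongly monotone
    variational inequality depends in a Lipschitz way on the right-hand side
    of the equations, with a constant in which neither [h] nor the data of [F]
    occurs except through [L] and [gamma].

    The polyhedral part of this is [ex_projection_lipschitz]: the projection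
    of a fixed point [v] on the set [G u <= h, A u = b] is Lipschitz in [b],
    with a constant depending on [A] and [G] only.  It is proved by induction
    on the number of rows of [G].  Without inequalities, the difference of two
    projections is orthogonal to the kernel of [A], and a partial inverse of
    [A] bounds it.  For one more row [g u <= c], move [b] along the segment
    from [b0] to [b1] and follow the projection [X t] on the set without this
    row.  Where [g (X t) <= c], the constrained projection is [X t]; where
    [g (X t) > c], the constraint is active, so the constrained projection is
    also the one for the system with the equation [g u = c] added to [A].
    Both regimes are covered by the induction hypothesis.  If the two endpoints
    are in different regimes, then [X] is continuous by the induction
    hypothesis, so [g (X t) = c] for some [t], and [X t] belongs to both
    regimes: it is an intermediate point for the triangle inequality.  This
    replaces Hoffman's bound and any choice of multipliers.

    The passage from projections to [F] is [vi_perturbation].  Since [x] is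
    the projection of [x - grad F x] on its slice, the projection [x'] of the
    same point on the slice [A u = b] satisfies [|x' - x| <= k * |A x - b|].
    Testing the inequality of [xs] at [x'] and that of [x'] at [xs], and using
    strong monotonicity, gives [gamma * |x - xs| <= (1 + L) * |x' - x|]. *)

Section ErrorBound.
Context {R : realType}.
Set Implicit Arguments.
Unset Strict Implicit.
Unset Printing Implicit Defensive.

(** * Euclidean geometry *)

Section Dot.
Context {n : nat}.
Implicit Types (x y u v : 'cV[R]_n) (a : R).

Lemma dotvC x y : dotv x y = dotv y x.
Proof. by apply: eq_bigr => i _; rewrite mulrC. Qed.

Lemma dotvDl x y v : dotv (x + y) v = dotv x v + dotv y v.
Proof. by rewrite -big_split; apply: eq_bigr => i _ /=; rewrite mxE mulrDl. Qed.

Lemma dotvZl a x v : dotv (a *: x) v = a * dotv x v.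
Proof. by rewrite mulr_sumr; apply: eq_bigr => i _; rewrite mxE mulrA. Qed.

Lemma dotvNl x v : dotv (- x) v = - dotv x v.
Proof. by rewrite -scaleN1r dotvZl mulN1r. Qed.

Lemma dotvBl x y v : dotv (x - y) v = dotv x v - dotv y v.
Proof. by rewrite dotvDl dotvNl. Qed.

Lemma dotvDr v x y : dotv v (x + y) = dotv v x + dotv v y.
Proof. by rewrite dotvC dotvDl !(dotvC v). Qed.

Lemma dotvZr a x v : dotv v (a *: x) = a * dotv v x.
Proof. by rewrite dotvC dotvZl (dotvC v). Qed.

Lemma dotvNr x v : dotv v (- x) = - dotv v x.
Proof. by rewrite dotvC dotvNl (dotvC v). Qed.

Lemma dotvBr v x y : dotv v (x - y) = dotv v x - dotv v y.
Proof. by rewrite dotvDr dotvNr. Qed.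

Lemma dotv0r x : dotv x 0 = 0.
Proof. by rewrite -(scale0r x) dotvZr mul0r. Qed.

Lemma sqr_enorm x : enorm x ^+ 2 = dotv x x.
Proof.
rewrite sqr_sqrtr; last by apply: sumr_ge0 => i _; exact: sqr_ge0.
by apply: eq_bigr => i _; rewrite expr2.
Qed.

Lemma enorm_ge0 x : 0 <= enorm x.
Proof. exact: sqrtr_ge0. Qed.

Lemma coord_le_enorm x i : `|x i 0| <= enorm x.
Proof.
rewrite -sqrtr_sqr ler_wsqrtr// (bigD1 i)//= lerDl sumr_ge0// => j _.
exact: sqr_ge0.
Qed.

Lemma enorm_eq0 x : enorm x = 0 -> x = 0.
Proof.
move=> x0; apply/matrixP => i j; rewrite mxE ord1.
by have := coord_le_enorm x i; rewrite x0 normr_le0 => /eqP.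
Qed.

Lemma enorm0 : enorm (0 : 'cV[R]_n) = 0.
Proof. by apply/eqP; rewrite -sqrf_eq0 sqr_enorm dotv0r. Qed.

Lemma enormZ a x : enorm (a *: x) = `|a| * enorm x.
Proof.
apply: (@pexpIrn _ 2) => //; rewrite ?nnegrE ?mulr_ge0 ?enorm_ge0//.
by rewrite exprMn real_normK ?num_real// !sqr_enorm dotvZl dotvZr mulrA -expr2.
Qed.

Lemma enormN x : enorm (- x) = enorm x.
Proof. by rewrite -scaleN1r enormZ normrN1 mul1r. Qed.

Lemma enorm_distC x y : enorm (x - y) = enorm (y - x).
Proof. by rewrite -opprB enormN. Qed.

Lemma ler_dotv x y : dotv x y <= enorm x * enorm y.
Proof.
have [/enorm_eq0->|x0] := eqVneq (enorm x) 0.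
  by rewrite dotvC dotv0r enorm0 mul0r.
have [/enorm_eq0->|y0] := eqVneq (enorm y) 0.
  by rewrite dotv0r enorm0 mulr0.
have xy0 : 0 < enorm x * enorm y.
  by rewrite mulr_gt0// lt_neqAle eq_sym enorm_ge0 andbT.
have := sqr_ge0 (enorm (enorm y *: x - enorm x *: y)).
rewrite sqr_enorm dotvBl !dotvBr !dotvZl !dotvZr -!sqr_enorm (dotvC y x).
move=> H; rewrite -(ler_pM2l xy0); lra.
Qed.

Lemma ler_enormD x y : enorm (x + y) <= enorm x + enorm y.
Proof.
rewrite -(@ler_pXn2r _ 2) ?nnegrE ?addr_ge0 ?enorm_ge0//.
rewrite sqr_enorm dotvDl !dotvDr (dotvC y x) sqrrD -!sqr_enorm.
have := ler_dotv x y; lra.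
Qed.

Lemma ler_dotv_opp x y : - (enorm x * enorm y) <= dotv x y.
Proof. by rewrite lerNl -dotvNl -(enormN x) ler_dotv. Qed.

End Dot.

Lemma dotv_mulmx_trl m n (A : 'M[R]_(m, n)) (y : 'cV[R]_m) (x : 'cV[R]_n) :
  dotv (A^T *m y) x = dotv y (A *m x).
Proof.
have dotvE k (u v : 'cV[R]_k) : dotv u v = (u^T *m v) 0 0.
  by rewrite mxE; apply: eq_bigr => i _; rewrite mxE.
by rewrite !dotvE trmx_mul trmxK mulmxA.
Qed.

Lemma enorm_le_sum n (x : 'cV[R]_n) : enorm x <= \sum_i `|x i 0|.
Proof.
have s0 : 0 <= \sum_i `|x i 0| by apply: sumr_ge0.
rewrite -(@ler_pXn2r _ 2) ?nnegrE ?enorm_ge0// sqr_enorm expr2 mulr_suml.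
apply: ler_sum => i _.
rewrite (le_trans (ler_norm _))// normrM ler_wpM2l// (bigD1 i)//= lerDl.
exact: sumr_ge0.
Qed.

Lemma mulmx_bounded m n (M : 'M[R]_(m, n)) :
  exists2 c, 0 <= c & forall x : 'cV_n, enorm (M *m x) <= c * enorm x.
Proof.
exists (\sum_i \sum_j `|M i j|); first by do 2!apply: sumr_ge0 => ? _.
move=> x; apply: le_trans (enorm_le_sum _) _.
rewrite mulr_suml; apply: ler_sum => i _; rewrite mxE mulr_suml.
apply: le_trans (ler_norm_sum _ _ _) _; apply: ler_sum => j _.
by rewrite normrM ler_wpM2l// coord_le_enorm.
Qed.

Lemma is_derive_line n (F : 'cV[R]_n -> R) x d t c :
  is_derive (x + t *: d) d F c ->
  is_derive t (1 : R) (fun s => F (x + s *: d)) c.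
Proof.
have E : (fun h : R => h^-1 *: (((fun s => F (x + s *: d)) \o shift t)
    (h *: (1 : R)) - F (x + t *: d))) =
  (fun h : R => h^-1 *: ((F \o shift (x + t *: d)) (h *: d) - F (x + t *: d))).
  apply/funext => h /=; congr (_ *: (F _ - _)).
  by rewrite [h *: 1]mulr1 scalerDl addrCA.
by move=> [? <-]; apply: DeriveDef; rewrite /derivable/derive E.
Qed.

(** * Minimizers and variational inequalities *)

Section VariationalInequalities.
Context {n : nat}.
Implicit Types (S : set 'cV[R]_n) (F : 'cV[R]_n -> R)
  (g : 'cV[R]_n -> 'cV[R]_n).

Definition segment_closed S :=
  forall u v t, S u -> S v -> 0 <= t <= 1 -> S (u + t *: (v - u)).

Definition solves_vi S (g x : 'cV[R]_n) :=
  S x /\ forall u, S u -> 0 <= dotv g (u - x).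

Definition strongly_monotone S g (gamma : R) :=
  forall u v, S u -> S v ->
    gamma * enorm (u - v) ^+ 2 <= dotv (g u - g v) (u - v).

(** Directional derivatives are all that the first-order conditions use, and
    they are computed more easily than the differential. *)
Definition has_gradient F g := forall x d, is_derive x d F (dotv (g x) d).

(** The difference quotients of [F] along [u - x] are nonnegative for steps in
    the unit interval, so the right derivative is. *)
Lemma argmin_solves_vi S F g x :
  segment_closed S -> has_gradient F g -> is_argmin S F x ->
  solves_vi S (g x) x.
Proof.
move=> cS dF [Sx Fx]; split=> // u Su.
have [dx <-] := dF x (u - x).
rewrite /derive cvg_at_rightE; last exact: dx.
apply: limr_ge.
  rewrite -(cvg_at_rightE (fun h : R => h^-1 *: ((F \o shift x) _ - F x)))//.
  apply: cvg_trans dx; apply: cvg_app => B [e e0 Be].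
  by exists e => // r re r0; apply: Be => //; exact: lt0r_neq0.
near=> h.
have h0 : 0 < h by near: h; exact: nbhs_right_gt.
apply: mulr_ge0; first by rewrite invr_ge0 ltW.
rewrite /= subr_ge0 addrC.
apply/Fx/cS => //; rewrite ltW//=; near: h.
exact: nbhs_right_le.
Unshelve. all: end_near. Qed.

(** Strong convexity on [S] only: the mean value theorem is applied along the
    segment to [F] minus the quadratic whose derivative bounds that of [F]. *)
Lemma quadratic_lower_bound S F g gamma x u :
  segment_closed S -> has_gradient F g -> strongly_monotone S g gamma ->
  S x -> S u ->
  F x + dotv (g x) (u - x) + gamma / 2 * enorm (u - x) ^+ 2 <= F u.
Proof.
move=> cS dF mg Sx Su; set d := u - x; set c := gamma * enorm d ^+ 2.
pose phi := fun s : R => F (x + s *: d).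
pose psi := fun s : R => phi s - (dotv (g x) d * s + c / 2 * s ^+ 2).
have dpsi s : is_derive s (1 : R) psi
    (dotv (g (x + s *: d)) d - (dotv (g x) d + c * s)).
  have dphi : is_derive s (1 : R) phi (dotv (g (x + s *: d)) d).
    by apply: is_derive_line; exact: dF.
  apply: is_derive_eq.
  congr (_ - _); rewrite /GRing.scale/=; lra.
have cpsi : {within `[0, 1], continuous psi}.
  apply: continuous_subspaceT => s; apply: differentiable_continuous.
  by apply/derivable1_diffP; case: (dpsi s).
have [s s01] := MVT ltr01 (fun s _ => dpsi s) cpsi.
move: s01; rewrite in_itv/= => /andP[s0 s1].
rewrite subr0 mulr1 /psi /phi scale1r scale0r addr0 [x + d]addrCA subrr addr0.
have := mg _ _ (cS x u s Sx Su _) Sx; rewrite (ltW s0) (ltW s1) => /(_ isT).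
rewrite -/d addrAC subrr add0r enormZ dotvZr gtr0_norm// exprMn dotvBl.
rewrite mulrCA -/c expr2 -mulrA ler_pM2l// => H.
move=> E; rewrite [gamma / 2 * _]mulrAC -/c; lra.
Qed.

(** By the quadratic lower bound, the sublevel set of [F] at a point of [S] is
    bounded, hence compact in finite dimension. *)
Lemma ex_argmin S F g gamma :
  S !=set0 -> closed S -> segment_closed S -> continuous F ->
  has_gradient F g -> 0 < gamma -> strongly_monotone S g gamma ->
  exists x, is_argmin S F x.
Proof.
move=> [x0 Sx0] clS cS cF dF gamma0 mg.
pose M := 2 * enorm (g x0) / gamma.
(* Transposition carries the problem to row vectors, where closed bounded
   sets are compact. *)
have cT : continuous (@trmx R 1 n).
  move=> r B /nbhs_ballP[e e0 eB]; apply/nbhs_ballP; exists e => // s [_ rs].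
  by apply: eB; split=> // i k; rewrite !mxE; exact: rs.
pose S' := [set r : 'rV[R]_n | S r^T /\ F r^T <= F x0].
have [|||r] := @EVT_min_rV R n (F \o trmx) S'.
- by exists x0^T; rewrite /S' /= trmxK; split.
- apply: bounded_closed_compact.
  + exists (M + enorm x0); split; first exact: num_real.
    move=> B MB r [Sr Fr].
    have B0 : 0 <= B.
      apply: le_trans (ltW MB); rewrite addr_ge0 ?enorm_ge0//.
      by rewrite divr_ge0 ?mulr_ge0 ?enorm_ge0// ltW.
    have rx0 : enorm (r^T - x0) <= M.
      have := quadratic_lower_bound cS dF mg Sx0 Sr.
      have := ler_dotv_opp (g x0) (r^T - x0).
      move: (enorm_ge0 (r^T - x0)); set D := enorm _.
      rewrite /M ler_pdivlMr// le_eqVlt => /predU1P[<-|D0 CS Q].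
        by rewrite mul0r mulr_ge0 ?enorm_ge0.
      by rewrite -(ler_pM2r D0); nra.
    have rB : enorm r^T <= B.
      rewrite -[r^T](subrK x0) (le_trans (ler_enormD _ _))//.
      by rewrite (le_trans _ (ltW MB))// lerD2r.
    rewrite {1}/Num.norm/= mx_normrE; apply: bigmax_le => // -[i k] _ /=.
    by have := coord_le_enorm r^T k; rewrite mxE ord1 => /le_trans; apply.
  + apply: closedI; first exact: preimage_closed.
    apply: (preimage_closed (f := F \o trmx) (D := [set y | y <= F x0])).
      by move=> r _; apply: continuous_comp; [exact: cT|exact: cF].
    exact: closed_le.
- apply: continuous_subspaceT => r.
  by apply: continuous_comp; [exact: cT|exact: cF].
- rewrite inE => -[Sr Fr] min; exists r^T; split=> // u Su.
  have [Fu|/ltW Fu] := leP (F u) (F x0).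
    have := min u^T; rewrite inE /S' /= trmxK; exact.
  exact: le_trans Fr Fu.
Qed.

End VariationalInequalities.

(** * Polyhedra *)

Lemma affine_segment m n (A : 'M[R]_(m, n)) (u v : 'cV_n) (t : R) :
  A *m (u + t *: (v - u)) = A *m u + t *: (A *m v - A *m u).
Proof. by rewrite mulmxDr -scalemxAr mulmxBr. Qed.

Lemma affine_segment_coord m n (A : 'M[R]_(m, n)) (u v : 'cV_n) (t : R) i :
  (A *m (u + t *: (v - u))) i 0 =
  (A *m u) i 0 + t * ((A *m v) i 0 - (A *m u) i 0).
Proof.
by rewrite affine_segment; move: (_ *m u) (_ *m v) => p q; rewrite !mxE.
Qed.

Lemma continuous_mulmx_coord m n (A : 'M[R]_(m, n)) (i : 'I_m) :
  continuous (fun x : 'cV[R]_n => (A *m x) i 0).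
Proof.
have -> : (fun x : 'cV[R]_n => (A *m x) i 0) =
          (fun x : 'cV[R]_n => \sum_j A i j * x j 0).
  by apply/funext => x; rewrite mxE.
apply: (@continuous_big _ _ +%R 0) => [|j _ x]; first exact: add_continuous.
apply: (@continuousM _ _ (fun=> A i j) (fun x : 'cV[R]_n => x j 0)).
  exact: cst_continuous.
exact: coord_continuous.
Qed.

Section Constraints.
Context {m n l : nat} (A : 'M[R]_(m, n)) (G : 'M[R]_(l, n)).

Lemma polyhedron_segment_closed h : segment_closed (polyhedron G h).
Proof.
move=> u v t Pu Pv /andP[t0 t1] i; rewrite affine_segment_coord.
have := Pu i; have := Pv i; nra.
Qed.

Lemma feasible_segment b0 b1 h u v t : feasible A b0 G h u ->
  feasible A b1 G h v -> 0 <= t <= 1 ->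
  feasible A (b0 + t *: (b1 - b0)) G h (u + t *: (v - u)).
Proof.
move=> [Pu <-] [Pv <-] t01; split; first exact: polyhedron_segment_closed.
exact: affine_segment.
Qed.

Lemma feasible_segment_closed b h : segment_closed (feasible A b G h).
Proof.
move=> u v t Fu Fv t01; have := feasible_segment Fu Fv t01.
by rewrite subrr scaler0 addr0.
Qed.

Lemma closed_polyhedron h : closed (polyhedron G h).
Proof.
rewrite (_ : polyhedron G h =
  \bigcap_i (fun x => (G *m x) i 0) @^-1` [set y | y <= h i 0]).
  apply: closed_bigI => i _; apply: preimage_closed; last exact: closed_le.
  by move=> x _; exact: continuous_mulmx_coord.
by apply/seteqP; split => x /= Px i => [_|]; exact: Px.
Qed.

Lemma closed_feasible b h : closed (feasible A b G h).
Proof.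
apply: closedI; first exact: closed_polyhedron.
rewrite (_ : mkset _ =
  \bigcap_i (fun x => (A *m x) i 0) @^-1` [set y | y = b i 0]).
  apply: closed_bigI => i _; apply: preimage_closed; last exact: closed_eq.
  by move=> x _; exact: continuous_mulmx_coord.
apply/seteqP; split => [x /= Ax i _|x /= Ax]; first by rewrite /= Ax.
by apply/matrixP => i j; rewrite ord1; exact: (Ax i I).
Qed.

End Constraints.

(** * Gradients of quadratic functions *)

(** The form in which derivatives of squared distances are computed: a second
    order expansion along the line that is exact. *)
Lemma is_derive_quadratic n (q : 'cV[R]_n -> R) x d c1 c2 :
  (forall t, q (x + t *: d) = q x + t * c1 + t ^+ 2 * c2) ->
  is_derive x d q c1.
Proof.
move=> qE; pose P (t : R) : R := q x + t * c1 + t ^+ 2 * c2.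
have dP : is_derive (0 : R) (1 : R) P c1.
  by apply: is_derive_eq; rewrite /GRing.scale/=; lra.
have E : (fun h : R => h^-1 *: ((q \o shift x) (h *: d) - q x)) =
         (fun h : R => h^-1 *: ((P \o shift 0) (h *: (1 : R)) - P 0)).
  apply/funext => h /=; congr (_ *: _).
  rewrite [h *: 1]mulr1 addr0 [h *: d + x]addrC qE /P; lra.
by move: dP => [? <-]; apply: DeriveDef; rewrite /derivable/derive E.
Qed.

Lemma has_gradientD n (F1 F2 : 'cV[R]_n -> R) g1 g2 :
  has_gradient F1 g1 -> has_gradient F2 g2 ->
  has_gradient (fun x => F1 x + F2 x) (fun x => g1 x + g2 x).
Proof. by move=> d1 d2 x d; rewrite dotvDl; exact: is_deriveD. Qed.

Lemma has_gradient_sqdist m n (A : 'M[R]_(m, n)) b (a : R) :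
  has_gradient (fun x => a / 2 * enorm (A *m x - b) ^+ 2)
               (fun x => a *: (A^T *m (A *m x - b))).
Proof.
move=> x d.
apply: (@is_derive_quadratic _ _ _ _ _ (a / 2 * enorm (A *m d) ^+ 2)) => t.
rewrite dotvZl dotv_mulmx_trl mulmxDr -scalemxAr addrAC !sqr_enorm.
rewrite !(dotvDl, dotvDr, dotvZl, dotvZr, dotvNl, dotvNr).
rewrite (dotvC (A *m d) (A *m x)) (dotvC (A *m d) b) (dotvC b (A *m x)); lra.
Qed.

Lemma continuous_sqdist m n (A : 'M[R]_(m, n)) b :
  continuous (fun x => enorm (A *m x - b) ^+ 2).
Proof.
rewrite (_ : (fun x => _) = fun x => \sum_i ((A *m x) i 0 - b i 0) ^+ 2).
  apply: (@continuous_big _ _ +%R 0) => [|i _ x]; first exact: add_continuous.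
  apply: (@continuous_comp _ _ _ (fun x : 'cV[R]_n => (A *m x) i 0 - b i 0)
    (fun y => y ^+ 2)).
    apply: (@continuousB _ _ _ (fun x : 'cV[R]_n => (A *m x) i 0) (fun=> b i 0)).
      exact: continuous_mulmx_coord.
    exact: cst_continuous.
  exact: (@exprn_continuous _ 2).
apply/funext => x; rewrite sqr_enorm; apply: eq_bigr => i _.
by rewrite mxE [(- b) i 0]mxE expr2.
Qed.

Lemma has_gradient_sqdist1 n (z : 'cV[R]_n) (a : R) :
  has_gradient (fun x : 'cV[R]_n => a / 2 * enorm (x - z) ^+ 2)
    (fun x => a *: (x - z)).
Proof.
have := has_gradient_sqdist 1%:M z a.
under eq_fun do rewrite mul1mx; rewrite trmx1.
by under [X in has_gradient _ X]eq_fun do rewrite !mul1mx.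
Qed.

Lemma continuous_sqdist1 n (z : 'cV[R]_n) :
  continuous (fun x : 'cV[R]_n => enorm (x - z) ^+ 2).
Proof.
by have := @continuous_sqdist _ _ 1%:M z; under eq_fun do rewrite mul1mx.
Qed.

Lemma continuous_cstM n (a : R) (F : 'cV[R]_n -> R) :
  continuous F -> continuous (fun x => a * F x).
Proof.
by move=> cF x; apply: (@continuousM _ _ (fun=> a) F);
  [exact: cst_continuous|exact: cF].
Qed.

(** * Projections *)

Section Projection.
Context {n : nat}.
Implicit Types (S T : set 'cV[R]_n) (x z : 'cV[R]_n).

(** The condition on [x] is the variational characterization of the projection
    of [z] on the convex set [S]. *)
Lemma ex_projection S z : S !=set0 -> closed S -> segment_closed S ->
  exists x, solves_vi S (x - z) x.
Proof.
move=> S0 clS cS; have dF := has_gradient_sqdist1 z 1.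
have [||x /(argmin_solves_vi cS dF)] := ex_argmin S0 clS cS _ dF ltr01.
- exact/continuous_cstM/continuous_sqdist1.
- by move=> u v _ _; rewrite !scale1r mul1r sqr_enorm opprB addrA subrK.
by rewrite scale1r; exists x.
Qed.

Lemma solves_vi_subset S T g x :
  T `<=` S -> T x -> solves_vi S g x -> solves_vi T g x.
Proof. by move=> TS Tx [_ vi]; split=> // u /TS; exact: vi. Qed.

(** Adding the two inequalities gives [|x - y|^2 <= 0]. *)
Lemma projection_eq z x y : 0 <= dotv (x - z) (y - x) ->
  0 <= dotv (y - z) (x - y) -> x = y.
Proof.
move=> xy yx; apply/eqP; rewrite -subr_eq0; apply/eqP/enorm_eq0/eqP.
rewrite -sqrf_eq0 eq_le sqr_ge0 andbT sqr_enorm.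
move: xy yx; rewrite !(dotvDl, dotvDr, dotvNl, dotvNr) (dotvC y x); lra.
Qed.

(** If the projection [x] on [S] cut by the half-space were interior to the
    half-space, one could move from [x] towards the projection [y] on [S] and
    stay feasible; then [x] and [y] would satisfy each other's inequality and
    coincide. *)
Lemma projection_active S (g : 'rV[R]_n) c z x y :
  segment_closed S ->
  solves_vi (S `&` [set u | (g *m u) 0 0 <= c]) (x - z) x ->
  solves_vi S (y - z) y -> c < (g *m y) 0 0 -> (g *m x) 0 0 = c.
Proof.
move=> cS [[Sx gx] vix] [Sy viy] gy; apply/eqP; rewrite eq_le gx leNgt/=.
apply/negP => {}gx.
have gxy : 0 < (g *m y) 0 0 - (g *m x) 0 0 by rewrite subr_gt0; lra.
(* The step at which the segment from [x] to [y] leaves the half-space. *)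
pose t := (c - (g *m x) 0 0) / ((g *m y) 0 0 - (g *m x) 0 0).
have t0 : 0 < t by rewrite divr_gt0// subr_gt0.
have t1 : t <= 1 by rewrite ler_pdivrMr// mul1r lerD2r ltW.
have /vix : (S `&` [set u | (g *m u) 0 0 <= c]) (x + t *: (y - x)).
  split; first by apply: cS; rewrite ?(ltW t0).
  by rewrite /= affine_segment_coord divfK ?gt_eqF// subrKC.
rewrite [x + t *: _]addrC addrK dotvZr pmulr_rge0// => xy.
by have := projection_eq xy (viy _ Sx) => exy; rewrite exy ltNge ltW in gx.
Qed.

End Projection.

(** * Lipschitz dependence of projections on the right-hand side *)

Lemma lipschitz_IVT (phi : R -> R) M c :
  (forall s t, 0 <= s <= 1 -> 0 <= t <= 1 ->
     `|phi s - phi t| <= M * `|s - t|) ->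
  phi 0 <= c <= phi 1 \/ phi 1 <= c <= phi 0 ->
  exists2 t, 0 <= t <= 1 & phi t = c.
Proof.
move=> Lphi bc; have [||t] := @IVT R phi 0 1 c ler01; last first.
- by rewrite in_itv/=; exists t.
- by rewrite ge_min le_max; case: bc => /andP[-> ->]; rewrite ?orbT.
apply/subspace_continuousP => t /=; rewrite in_itv/= => t01.
have M1 : 0 < `|M| + 1 by rewrite ltr_wpDl.
apply/cvgrPdist_le => e e0; near=> s.
have s01 : 0 <= s <= 1.
  by near: s; apply: withinT; rewrite //= => s; rewrite in_itv.
apply: le_trans (Lphi _ _ t01 s01) _.
have : `|t - s| <= e / (`|M| + 1).
  near: s; apply: cvg_within; apply/nbhs_ballP.
  exists (e / (`|M| + 1)); first exact: divr_gt0.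
  by move=> s; exact: ltW.
rewrite ler_pdivlMr// mulrC => /(le_trans _); apply.
by rewrite ler_wpM2r// (le_trans (ler_norm M))// lerDl.
Unshelve. all: end_near. Qed.

Lemma feasible_drop_row m n l (A : 'M[R]_(m, n)) (G : 'M[R]_(l.+1, n)) b h :
  feasible A b G h =
  feasible A b (row' ord0 G) (row' ord0 h) `&`
  [set x | (row ord0 G *m x) 0 0 <= h ord0 0].
Proof.
have rowE x : (row ord0 G *m x) 0 0 = (G *m x) ord0 0.
  by rewrite -row_mul mxE.
have row'E x i : (row' ord0 G *m x) i 0 = (G *m x) (lift ord0 i) 0.
  by rewrite !mxE; apply: eq_bigr => j _; rewrite mxE.
have hE i : row' ord0 h i 0 = h (lift ord0 i) 0 by rewrite mxE.
apply/seteqP; split => x /=.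
  move=> [Px Ax]; split; last by rewrite rowE; exact: Px.
  by split=> // i; rewrite row'E hE; exact: Px.
move=> [[Px Ax]]; rewrite rowE => P0; split=> // i.
by case: (unliftP ord0 i) => [j|] ->//; have := Px j; rewrite row'E hE.
Qed.

Lemma feasible_add_equation m n l (A : 'M[R]_(m, n)) (g : 'rV[R]_n)
    (G : 'M[R]_(l, n)) b c h :
  feasible (col_mx A g) (col_mx b (const_mx c)) G h =
  feasible A b G h `&` [set x | (g *m x) 0 0 = c].
Proof.
apply/seteqP; split => x /=.
  move=> [Px]; rewrite /= mul_col_mx => /eq_col_mx[Ax gx].
  by split => //; rewrite gx mxE.
move=> [[Px Ax] gx]; split=> //=; rewrite mul_col_mx Ax; congr col_mx.
by apply/matrixP => i j; rewrite !ord1 gx mxE.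
Qed.

Lemma enorm_col_mx0 m k (u : 'cV[R]_m) :
  enorm (col_mx u (0 : 'cV[R]_k)) = enorm u.
Proof.
rewrite /enorm big_split_ord/= [X in _ + X]big1 => [|i _]; last first.
  by rewrite col_mxEd mxE expr0n.
by rewrite addr0; congr Num.sqrt; apply: eq_bigr => i _; rewrite col_mxEu.
Qed.

(** The same [k] serves all [h] and [z]: the uniformity in [h] and [z] is what
    makes the final constant depend on [A] and [G] only. *)
Definition projection_lipschitz m n l (A : 'M[R]_(m, n)) (G : 'M[R]_(l, n))
    (k : R) :=
  forall b0 b1 h z x0 x1,
    solves_vi (feasible A b0 G h) (x0 - z) x0 ->
    solves_vi (feasible A b1 G h) (x1 - z) x1 ->
    enorm (x1 - x0) <= k * enorm (b1 - b0).

(** Write [d] for the difference of the projections.  Both [x0 - z] and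
    [x1 - z] are orthogonal to the kernel of [A], hence so is [d].  With
    [e = pinvmx A *m (A *m d)], the vector [d - e] is in this kernel, so
    [|d|^2] is the scalar product of [d] and [e], and [|e|] is bounded by a
    multiple of [|A *m d|]. *)
Lemma projection_lipschitz_affine m n (A : 'M[R]_(m, n)) (G : 'M[R]_(0, n)) :
  exists2 k, 0 <= k & projection_lipschitz A G k.
Proof.
have [k k0 kP] := mulmx_bounded (pinvmx A).
exists k => // b0 b1 h z x0 x1 sol0 sol1.
have [[[_ <-] _] [[_ <-] _]] := (sol0, sol1).
set d := x1 - x0; pose e := pinvmx A *m (A *m d).
have AE : A *m (d - e) = 0.
  suff -> : A *m (d - e) = A *m d - A *m d by rewrite subrr.
  by rewrite mulmxBr /e (mulmxA A) [_ *m (A *m d)]mulmxA mulmxKpV ?submx_refl.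
have perp b x : solves_vi (feasible A b G h) (x - z) x ->
    dotv (x - z) (d - e) = 0.
  move=> [[_ <-] vi]; apply/eqP; rewrite eq_le; apply/andP; split.
    rewrite -oppr_ge0 -dotvNr.
    have := vi (x - (d - e)); rewrite [_ - x]addrC addKr; apply.
    split; first by case.
    by rewrite /= mulmxBr AE subr0.
  have := vi (x + (d - e)); rewrite [_ - x]addrC addKr; apply.
  split; first by case.
  by rewrite /= mulmxDr AE addr0.
have : enorm d ^+ 2 = dotv d e.
  rewrite sqr_enorm -{2}(subrK e d) dotvDr.
  rewrite {1}(_ : d = x1 - z - (x0 - z)); last by rewrite opprB addrA subrK.
  by rewrite dotvBl (perp _ _ sol0) (perp _ _ sol1) subrr add0r.
have := ler_dotv d e; have := kP (A *m d); rewrite -/e mulmxBr.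
move=> ke de dE; have [->|d0] := eqVneq (enorm d) 0.
  by rewrite mulr_ge0 ?enorm_ge0.
have {}d0 : 0 < enorm d by rewrite lt_neqAle eq_sym d0 enorm_ge0.
rewrite -(ler_pM2l d0); apply: (@le_trans _ _ (enorm d * enorm e)).
  by rewrite -expr2 dE.
by rewrite ler_wpM2l ?enorm_ge0.
Qed.

(** The induction step compares, along the segment from [b0] to [b1], the
    projections for two systems with one inequality less: [S t], where the
    first inequality is dropped, and [S2 t], where it is turned into an
    equation. *)
Lemma ex_projection_lipschitz l m n (A : 'M[R]_(m, n)) (G : 'M[R]_(l, n)) :
  exists2 k, 0 <= k & projection_lipschitz A G k.
Proof.
elim: l m A G => [|l IHl] m A G; first exact: projection_lipschitz_affine.
set g := row ord0 G; set G' := row' ord0 G.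
have [k1 k1_ge0 Lk1] := IHl _ A G'.
have [k2 k2_ge0 Lk2] := IHl _ (col_mx A g) G'.
exists (k1 + k2) => [|b0 b1 h z x0 x1 sol0 sol1]; first exact: addr_ge0.
set c := h ord0 0; pose h' := row' ord0 h; pose b t := b0 + t *: (b1 - b0).
pose r := enorm (b1 - b0); have r0 : 0 <= r by exact: enorm_ge0.
pose S t := feasible A (b t) G' h'.
have b0E : b 0 = b0 by rewrite /b scale0r addr0.
have b1E : b 1 = b1 by rewrite /b scale1r addrC subrK.
have bB s t : enorm (b s - b t) = `|s - t| * r.
  by rewrite /b opprD addrACA subrr add0r -scalerBl enormZ.
move: sol0 sol1; rewrite !feasible_drop_row -b0E -b1E => sol0 sol1.
have /choice[X XP] t : exists x, 0 <= t <= 1 -> solves_vi (S t) (x - z) x.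
  have [t01|_] := boolP (0 <= t <= 1); last by exists 0.
  have [|||x vix] := ex_projection z (S := S t); last by exists x.
  - exists (x0 + t *: (x1 - x0)); rewrite /S /b.
    move: sol0 sol1 => [[+ _] _] [[+ _] _]; rewrite b0E b1E => F0 F1.
    exact: feasible_segment.
  - exact: closed_feasible.
  - exact: feasible_segment_closed.
have XL s t : 0 <= s <= 1 -> 0 <= t <= 1 ->
    enorm (X s - X t) <= k1 * (`|s - t| * r).
  by move=> /XP Xs /XP Xt; rewrite -bB; exact: Lk1 Xt Xs.
pose S2 t := feasible (col_mx A g) (col_mx (b t) (const_mx c)) G' h'.
have L2 s t x y : solves_vi (S2 s) (x - z) x -> solves_vi (S2 t) (y - z) y ->
    enorm (x - y) <= k2 * (`|s - t| * r).
  move=> xs ys; have := Lk2 _ _ _ _ _ _ ys xs.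
  by rewrite opp_col_mx add_col_mx subrr enorm_col_mx0 bB.
pose phi t := (g *m X t) 0 0.
have XS2 t : 0 <= t <= 1 -> phi t = c -> solves_vi (S2 t) (X t - z) (X t).
  move=> t01 tc; have Xt := XP t t01; have [SX _] := Xt.
  apply: solves_vi_subset Xt; rewrite /S2 feasible_add_equation.
    by move=> ? [].
  by [].
(* Each constrained projection solves one of the two smaller problems,
   according to the position of [X t]. *)
have cover t x : 0 <= t <= 1 ->
    solves_vi (S t `&` [set u | (g *m u) 0 0 <= c]) (x - z) x ->
    (phi t <= c -> x = X t) /\ (c < phi t -> solves_vi (S2 t) (x - z) x).
  move=> t01 solx; split=> phic.
    have [SX viX] := XP t t01; have [[Sx _] vix] := solx.
    by apply: (projection_eq (vix _ _) (viX _ _)).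
  have gx : (g *m x) 0 0 = c.
    apply: (projection_active _ solx (XP t t01) phic).
    exact: feasible_segment_closed.
  apply: (solves_vi_subset _ _ solx); rewrite /S2 feasible_add_equation.
    by move=> u [? /= ->].
  by split=> //; case: solx => -[].
have z01 : 0 <= (0 : R) <= 1 by rewrite lexx ler01.
have o01 : 0 <= (1 : R) <= 1 by rewrite lexx ler01.
have [x0X x0S] := cover _ _ z01 sol0; have [x1X x1S] := cover _ _ o01 sol1.
rewrite b0E b1E -/r.
(* The induction hypothesis for [S] makes the intermediate value theorem
   applicable to [phi]. *)
have phiL : exists M, forall s t, 0 <= s <= 1 -> 0 <= t <= 1 ->
    `|phi s - phi t| <= M * `|s - t|.
  have [kg kg0 gP] := mulmx_bounded g.
  exists (kg * k1 * r) => s t s01 t01.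
  have -> : phi s - phi t = (g *m (X s - X t)) 0 0.
    by rewrite mulmxBr /phi; move: (_ *m _) (_ *m _) => p q; rewrite !mxE.
  apply: le_trans (coord_le_enorm _ _) _; apply: le_trans (gP _) _.
  rewrite -!mulrA ler_wpM2l//; apply: le_trans (XL _ _ s01 t01) _.
  by rewrite [r * _]mulrC.
have [M /lipschitz_IVT phiIVT] := phiL.
have k1r := mulr_ge0 k1_ge0 r0; have k2r := mulr_ge0 k2_ge0 r0.
have [phi0|phi0] := leP (phi 0) c; have [phi1|phi1] := leP (phi 1) c.
- rewrite (x0X phi0) (x1X phi1).
  by have := XL _ _ o01 z01; rewrite subr0 normr1 mul1r mulrDl; lra.
(* The regimes differ at the endpoints: pass through a common point [X t]. *)
- have [|t t01 phit] := phiIVT c; first by left; rewrite phi0 ltW.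
  have D : enorm (x1 - x0) <= enorm (x1 - X t) + enorm (X t - x0).
    by rewrite -[x1 - x0](subrKA (X t)) ler_enormD.
  have := L2 _ _ _ _ (x1S phi1) (XS2 _ t01 phit).
  have := XL _ _ t01 z01; rewrite -(x0X phi0).
  move: t01 => /andP[t0 t1]; rewrite subr0 !ger0_norm ?subr_ge0//.
  have := mulr_ge0 t0 k1r; have := mulr_ge0 t0 k2r.
  rewrite -subr_ge0 in t1.
  by have := mulr_ge0 t1 k1r; have := mulr_ge0 t1 k2r; lra.
- have [|t t01 phit] := phiIVT c; first by right; rewrite phi1 ltW.
  have D : enorm (x1 - x0) <= enorm (x1 - X t) + enorm (X t - x0).
    by rewrite -[x1 - x0](subrKA (X t)) ler_enormD.
  have := L2 _ _ _ _ (XS2 _ t01 phit) (x0S phi0).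
  have := XL _ _ o01 t01; rewrite -(x1X phi1).
  move: t01 => /andP[t0 t1]; rewrite subr0 !ger0_norm ?subr_ge0//.
  have := mulr_ge0 t0 k1r; have := mulr_ge0 t0 k2r.
  rewrite -subr_ge0 in t1.
  by have := mulr_ge0 t1 k1r; have := mulr_ge0 t1 k2r; lra.
- have := L2 _ _ _ _ (x1S phi1) (x0S phi0).
  by rewrite subr0 normr1 mul1r mulrDl; lra.
Qed.

(** * The two minimizers *)

(** Here [y] is the projection of [x1 - g1] on [S].  The inequality of [x0] is
    tested at [y] and that of [y] at [x0]; in their sum every term besides
    [dotv (g1 - g0) (x1 - x0)] has a factor [v = y - x1], and the quadratic
    term in [v] has the favourable sign. *)
Lemma vi_perturbation n (S : set 'cV[R]_n) g0 g1 x0 x1 y gamma L :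
  0 <= L -> gamma * enorm (x1 - x0) ^+ 2 <= dotv (g1 - g0) (x1 - x0) ->
  enorm (g1 - g0) <= L * enorm (x1 - x0) ->
  solves_vi S g0 x0 -> solves_vi S (y - (x1 - g1)) y ->
  gamma * enorm (x1 - x0) <= (1 + L) * enorm (y - x1).
Proof.
move=> L0 mg Lg [Sx0 vi0] [Sy viy]; have := vi0 _ Sy; have := viy _ Sx0.
set D := enorm (x1 - x0) in mg Lg *; set V := enorm (y - x1).
have V0 : 0 <= V by exact: enorm_ge0.
have [->|D0] := eqVneq D 0; first by rewrite mulr0 mulr_ge0// addr_ge0.
have {}D0 : 0 < D by rewrite lt_neqAle eq_sym D0 enorm_ge0.
pose v := y - x1; pose d := x1 - x0.
have -> : y - (x1 - g1) = v + g1 by rewrite opprB addrCA addrC.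
have -> : y - x0 = v + d by rewrite /v /d addrA subrK.
have -> : x0 - y = - (v + d) by rewrite /v /d addrA subrK opprB.
have CS : - ((L * D) * V) <= dotv (g1 - g0) v.
  apply: le_trans (ler_dotv_opp _ _).
  by rewrite lerN2 ler_wpM2r.
have CS' : - (V * D) <= dotv v d := ler_dotv_opp v d.
have vv : 0 <= dotv v v by rewrite -sqr_enorm sqr_ge0.
clearbody D V.
rewrite -/d in mg.
clearbody v d; move: mg CS; rewrite !(dotvDl, dotvDr, dotvNl, dotvNr).
move=> mg CS viy' vi0'.
rewrite -(ler_pM2r D0); rewrite -mulrA -expr2; lra.
Qed.

Lemma has_gradient_gradient n (f : 'cV[R]_n -> R) :
  (forall x, differentiable f x) -> has_gradient f (gradient f).
Proof.
move=> df x d; apply: DeriveDef; first exact: diff_derivable.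
rewrite deriveE// {1}(matrix_sum_delta d) linear_sum.
apply: eq_bigr => i _; rewrite big_ord1 linearZ/= mxE deriveE// mulrC.
by [].
Qed.

Lemma has_gradient_pairing m n (A : 'M[R]_(m, n)) y b :
  has_gradient (fun x => dotv y (A *m x - b)) (fun=> A^T *m y).
Proof.
move=> x d; apply: (@is_derive_quadratic _ _ _ _ _ 0) => t.
by rewrite mulr0 addr0 dotv_mulmx_trl mulmxDr -scalemxAr addrAC dotvDr dotvZr.
Qed.

Lemma continuous_pairing m n (A : 'M[R]_(m, n)) y b :
  continuous (fun x => dotv y (A *m x - b)).
Proof.
apply: (@continuous_big _ _ +%R 0) => [|i _]; first exact: add_continuous.
apply: continuous_cstM => x.
have -> : (fun x => (A *m x - b) i 0) = (fun x => (A *m x) i 0 - b i 0).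
  by apply/funext => u; rewrite mxE [(- b) i 0]mxE.
apply: (@continuousB _ _ _ (fun x : 'cV[R]_n => (A *m x) i 0) (fun=> b i 0)).
  exact: continuous_mulmx_coord.
exact: cst_continuous.
Qed.

Section Prox.
Context {n : nat} (P : set 'cV[R]_n) (f : 'cV[R]_n -> R) (Lf p : R)
  (z : 'cV[R]_n).
Hypothesis f_smooth : smooth f.
Hypothesis f_lip : forall x y, P x -> P y ->
  enorm (gradient f x - gradient f y) <= Lf * enorm (x - y).

Definition prox_gradient x := gradient f x + p *: (x - z).

(** The Lipschitz bound on the gradient of [f] costs at most [Lf] in
    monotonicity, and the proximal term brings [p]. *)
Lemma prox_gradient_monotone : strongly_monotone P prox_gradient (p - Lf).
Proof.
move=> u v Pu Pv; rewrite /prox_gradient opprD addrACA -scalerBr opprB.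
rewrite [u - z + _]addrA subrK dotvDl dotvZl -sqr_enorm.
have := ler_dotv_opp (gradient f u - gradient f v) (u - v).
have := ler_wpM2r (enorm_ge0 (u - v)) (f_lip Pu Pv); lra.
Qed.

Lemma prox_gradient_lipschitz u v : 0 <= p -> P u -> P v ->
  enorm (prox_gradient u - prox_gradient v) <= (Lf + p) * enorm (u - v).
Proof.
move=> p0 Pu Pv; rewrite /prox_gradient opprD addrACA -scalerBr opprB.
rewrite [u - z + _]addrA subrK; apply: le_trans (ler_enormD _ _) _.
by rewrite enormZ ger0_norm// mulrDl lerD2r f_lip.
Qed.

Lemma prox_has_gradient :
  has_gradient (fun x => f x + p / 2 * enorm (x - z) ^+ 2) prox_gradient.
Proof.
apply: has_gradientD; last exact: has_gradient_sqdist1.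
by apply: has_gradient_gradient; case: f_smooth.
Qed.

Lemma prox_continuous : continuous (fun x => f x + p / 2 * enorm (x - z) ^+ 2).
Proof.
move=> x; apply: (@continuousD _ _ _ f); last first.
  exact/continuous_cstM/continuous_sqdist1.
by apply: differentiable_continuous; case: f_smooth.
Qed.

End Prox.

Lemma argmin_spec n (S : set 'cV[R]_n) F :
  (exists x, is_argmin S F x) -> is_argmin S F (argmin S F).
Proof. exact: getPex. Qed.

Section Problem.
Context {m l n : nat} (A : 'M[R]_(m, n)) (G : 'M[R]_(l, n)).
Context (b : 'cV[R]_m) (h : 'cV[R]_l) (f : 'cV[R]_n -> R) (Lf rho p : R).
Hypothesis feas : feasible A b G h !=set0.
Hypothesis f_smooth : smooth f.
Hypothesis f_lip : forall x y, polyhedron G h x -> polyhedron G h y ->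
  enorm (gradient f x - gradient f y) <= Lf * enorm (x - y).
Hypothesis rho0 : 0 <= rho.
Hypothesis Lfp : Lf < p.
Variable z : 'cV[R]_n.

Local Notation gF := (prox_gradient f p z).

Lemma xbar_star_solves_vi :
  solves_vi (feasible A b G h) (gF (xbar_star A b G h f p z))
    (xbar_star A b G h f p z).
Proof.
have cS := @feasible_segment_closed m n l A G b h.
have dF := prox_has_gradient p z f_smooth.
apply: (argmin_solves_vi cS dF); apply: argmin_spec.
have Lfp' : 0 < p - Lf by rewrite subr_gt0.
apply: (ex_argmin feas _ cS _ dF Lfp').
- exact: closed_feasible.
- exact: prox_continuous.
- by move=> u v [Pu _] [Pv _]; exact: (prox_gradient_monotone p z f_lip).
Qed.

(** The gradient of the augmented Lagrangian differs from that of [F] by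
    [A^T *m (y + rho *: (A *m x - b))], which is orthogonal to [u - x] as soon
    as [A *m u = A *m x]: the multiplier disappears. *)
Lemma x_of_solves_vi y :
  solves_vi (feasible A (A *m x_of A b G h f rho p y z) G h)
    (gF (x_of A b G h f rho p y z)) (x_of A b G h f rho p y z).
Proof.
pose gK x := gradient f x + A^T *m y + rho *: (A^T *m (A *m x - b))
  + p *: (x - z).
have cS := @polyhedron_segment_closed n l G h.
have dK : has_gradient (fun x => K A b f rho p x z y) gK.
  apply: has_gradientD; last exact: has_gradient_sqdist1.
  apply: has_gradientD; last exact: has_gradient_sqdist.
  apply: has_gradientD; last exact: has_gradient_pairing.
  by apply: has_gradient_gradient; case: f_smooth.
have gKE x : gK x = gF x + A^T *m (y + rho *: (A *m x - b)).
  by rewrite /gK /prox_gradient [A^T *m (y + _)]mulmxDr -scalemxAr -!addrA;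
    congr (_ + _); rewrite [RHS]addrCA; congr (_ + _); exact: addrC.
have Lfp' : 0 < p - Lf by rewrite subr_gt0.
have : solves_vi (polyhedron G h) (gK (x_of A b G h f rho p y z))
    (x_of A b G h f rho p y z).
  apply: (argmin_solves_vi cS dK); apply: argmin_spec.
  apply: (ex_argmin _ _ cS _ dK Lfp').
  - by case: feas => x [Px _]; exists x.
  - exact: closed_polyhedron.
  - move=> x; apply: (@continuousD _ _ _ (fun x => f x + dotv y (A *m x - b)
      + rho / 2 * enorm (A *m x - b) ^+ 2)); last first.
      exact/continuous_cstM/continuous_sqdist1.
    apply: (@continuousD _ _ _ (fun x => f x + dotv y (A *m x - b))); last first.
      exact/continuous_cstM/continuous_sqdist.
    apply: (@continuousD _ _ _ f); last exact: continuous_pairing.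
    by apply: differentiable_continuous; case: f_smooth.
  - move=> u v Pu Pv; rewrite !gKE opprD addrACA dotvDl.
    apply: le_trans (prox_gradient_monotone p z f_lip Pu Pv) _.
    rewrite lerDl -mulmxBr dotv_mulmx_trl opprD addrACA subrr add0r.
    rewrite -scalerBr opprB addrA subrK -mulmxBr dotvZl -sqr_enorm.
    by rewrite mulr_ge0// sqr_ge0.
set x := x_of _ _ _ _ _ _ _ _ _ => -[Px vix]; split=> // u [Pu /= Au].
have := vix u Pu; rewrite gKE dotvDl dotv_mulmx_trl mulmxBr Au subrr.
by rewrite dotv0r addr0.
Qed.

End Problem.

End ErrorBound.

Theorem lemma3p2 (R : realType) (m n l : nat)
    (A : 'M[R]_(m, n)) (G : 'M[R]_(l, n)) (L gamma : R) :
  exists2 sigma5 : R, 0 < sigma5 &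
    forall (b : 'cV[R]_m) (h : 'cV[R]_l) (f : 'cV[R]_n -> R) (Lf rho p : R),
      feasible A b G h !=set0 ->
      smooth f ->
      (forall x x', polyhedron G h x -> polyhedron G h x' ->
         enorm (gradient f x - gradient f x') <= Lf * enorm (x - x')) ->
      (exists c : R, forall x, feasible A b G h x -> c <= f x) ->
      0 <= rho ->
      0 < p ->
      Lf < p ->
      L = Lf + rho * sigma_max A ^+ 2 + p ->
      gamma = p - Lf ->
      forall (y : 'cV[R]_m) (z : 'cV[R]_n),
        enorm (x_of A b G h f rho p y z - xbar_star A b G h f p z)
        <= sigma5 * enorm (A *m x_of A b G h f rho p y z - b).
Proof.
have [k k0 kP] := ex_projection_lipschitz A G.
have L0 : 0 <= 1 + `|L| by rewrite addr_ge0.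
(* The absolute values and the final [+ 1] make the constant positive for
   every [L] and [gamma], also for values that no problem attains. *)
exists ((1 + `|L|) * k / `|gamma| + 1).
  by rewrite ltr_wpDl// divr_ge0// mulr_ge0.
move=> b h f Lf rho p feas sf Lip _ rho0 p0 Lfp LE gammaE y z.
have gamma0 : 0 < gamma by rewrite gammaE subr_gt0.
have := x_of_solves_vi feas sf Lip rho0 Lfp z y.
have := xbar_star_solves_vi feas sf Lip Lfp z.
set x := x_of _ _ _ _ _ _ _ _ _; set xs := xbar_star _ _ _ _ _ _ _.
set g1 := prox_gradient f p z x; set g0 := prox_gradient f p z xs => vixs vix.
have [Px Pxs] : polyhedron G h x /\ polyhedron G h xs.
  by case: vixs => -[Pxs _] _; case: vix => -[Px _] _.
(* Since [x - (x - g1) = g1], the point [x] is itself the projection of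
   [x - g1] on its own slice. *)
have [x' vix'] := ex_projection (x - g1) feas (@closed_feasible _ _ _ _ A G b h)
  (@feasible_segment_closed _ _ _ _ A G b h).
have Lx : enorm (x' - x) <= k * enorm (A *m x - b).
  rewrite enorm_distC [enorm (A *m x - b)]enorm_distC enorm_distC.
  by apply: (kP _ _ h (x - g1)) vix'; rewrite opprB addrC subrK.
have Lg : enorm (g1 - g0) <= `|L| * enorm (x - xs).
  apply: le_trans (prox_gradient_lipschitz z Lip (ltW p0) Px Pxs) _.
  rewrite ler_wpM2r ?enorm_ge0// (le_trans _ (ler_norm L))// LE addrAC lerDl.
  by rewrite mulr_ge0// sqr_ge0.
have mg := prox_gradient_monotone p z Lip Px Pxs; rewrite -gammaE in mg.
have := vi_perturbation (normr_ge0 L) mg Lg vixs vix'.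
rewrite mulrC -ler_pdivlMr// => /le_trans; apply.
rewrite (gtr0_norm gamma0) [(_ + 1) * _]mulrDl mul1r ler_wpDr ?enorm_ge0//.
rewrite [_ * _ * enorm _]mulrAC -[_ * k * _]mulrA.
by rewrite ler_wpM2r ?invr_ge0 ?(ltW gamma0)// ler_wpM2l.
Qed.
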